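(* Let $n\ge 4$ be an integer with $4\mid n$, and let $W(D_n)$ be the $n\times n$ walk matrix of the Dynkin graph $D_n$. Then the Smith normal form of $W(D_n)$ over $\mathbb{Z}$ is $$\operatorname{diag}[\underbrace{1,1,\ldots,1}_{\frac{n}{2}-1},\underbrace{2,2,\ldots,2}_{\frac{n}{2}-1},0,0].$$
   Context: The Dynkin graph $D_n$ ($n\ge 4$) is the tree on vertices $1,2,\ldots,n$ whose edges are $\{1,3\}$, $\{2,3\}$ and $\{i,i+1\}$ for $3\le i\le n-1$ (a path $3,4,\ldots,n$ with two additional leaves $1,2$ attached to vertex $3$). For a graph $G$ on $n$ vertices with adjacency matrix $A$, the walk matrix is $W(G)=[e,Ae,A^2e,\ldots,A^{n-1}e]$, where $e$ is the all-one column vector of length $n$. The Smith normal form of an $n\times n$ integer matrix $M$ is the unique diagonal matrix $\operatorname{diag}[d_1,\ldots,d_n]=PMQ$ with $P,Q$ unimodular integer matrices, all $d_i\ge 0$ and $d_i\mid d_{i+1}$ for $1\le i\le n-1$ (with the convention $0\mid 0$). *)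

(* Defs.v *)
From HB Require Import structures.
From mathcomp Require Import all_boot all_order all_algebra.

Set Implicit Arguments.
Unset Strict Implicit.
Unset Printing Implicit Defensive.

Import Order.TTheory GRing.Theory Num.Theory.
Local Open Scope ring_scope.

(* Each edge of D_n written once, as (smaller, larger) endpoint, in the vertex
   labels 1, ..., n; the bound larger <= n comes from the vertex type below. *)
Definition dynkinD_arc (u v : nat) : bool :=
  [|| (u == 1%N) && (v == 3%N),
      (u == 2%N) && (v == 3%N)
    | (3 <= u)%N && (v == u.+1)].

(* The ordinal i : 'I_n stands for the vertex labelled i.+1. *)
Definition dynkinD (n : nat) : rel 'I_n :=
  fun i j => dynkinD_arc i.+1 j.+1 || dynkinD_arc j.+1 i.+1.

Definition adjacency_mx (n : nat) (e : rel 'I_n) : 'M[int]_n :=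
  \matrix_(i, j) (e i j)%:R.

Definition walk_mx (n : nat) (e : rel 'I_n) : 'M[int]_n :=
  \matrix_(i, j) (adjacency_mx e ^+ j *m (const_mx 1 : 'cV[int]_n)) i 0.

(* Unimodular is rendered by unitmx: the units of int are 1 and -1.
   The convention 0 | 0 is that of dvdz. *)
Definition is_smith_normal_form (n : nat) (M D : 'M[int]_n) : Prop :=
  exists d : 'I_n -> int,
    [/\ D = diag_mx (\row_i d i),
        forall i : 'I_n, 0 <= d i,
        forall i j : 'I_n, j = i.+1 :> nat -> (d i %| d j)%Z
      & exists P Q : 'M[int]_n,
          [/\ P \in unitmx, Q \in unitmx & D = P *m M *m Q]].

(* Main.v *)
Require Import Defs.
From mathcomp Require Import all_boot all_order all_algebra.
From mathcomp Require Import perm zify ring.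
Import Order.TTheory GRing.Theory Num.Theory.
Local Open Scope ring_scope.

(* Replacing the column A^k e of the walk matrix by p_k(A) e, where p_k is the
   monic Chebyshev polynomial with p_k(x + 1/x) = x^k + 1/x^k, is a unimodular
   column operation, and p_k(A) e has a closed form: e unfolds to a square wave
   plus point masses on a cycle, where A acts as the sum of the two unit shifts.
   With n = 2m + 2, the new matrix is, up to the order of rows and columns and
   after clearing a repeated row, a zero column and a pivot 1, the matrix
     K = [F + F^T, F - F^T; F^T - F, 2 - F - F^T]
   where F is the upper triangular m x m matrix of ones.  Since F inverts 1 - N
   for the superdiagonal shift N, two block operations turn K into
   diag(2, N + N^T), and N + N^T is the adjacency matrix of a path on m
   vertices.  When 4 | n, m is odd, and removing pendant edges reduces that
   matrix to diag(1, ..., 1, 0). *)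

Set Implicit Arguments.
Unset Strict Implicit.

(** * Equivalence of square matrices up to invertible factors *)

Section MatrixEquivalence.
Variable R : comUnitRingType.

Definition mx_equiv n (M N : 'M[R]_n) : Prop :=
  exists P Q : 'M[R]_n, [/\ P \in unitmx, Q \in unitmx & N = P *m M *m Q].

Lemma mx_equiv_trans n (M N L : 'M[R]_n) :
  mx_equiv M N -> mx_equiv N L -> mx_equiv M L.
Proof.
move=> [P [Q [uP uQ ->]]] [P' [Q' [uP' uQ' ->]]].
exists (P' *m P), (Q *m Q'); rewrite !unitmx_mul uP uQ uP' uQ'.
by split=> //; rewrite !mulmxA.
Qed.

Lemma mx_equivMr n (M Q : 'M[R]_n) : Q \in unitmx -> mx_equiv M (M *m Q).
Proof. by move=> uQ; exists 1%:M, Q; rewrite unitmx1 mul1mx. Qed.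

Lemma mx_equivMl n (P M : 'M[R]_n) : P \in unitmx -> mx_equiv M (P *m M).
Proof. by move=> uP; exists P, 1%:M; rewrite unitmx1 mulmx1. Qed.

Lemma mx_equiv_refl n (M : 'M[R]_n) : mx_equiv M M.
Proof. by rewrite -{2}[M]mulmx1; apply: mx_equivMr; rewrite unitmx1. Qed.

Lemma mx_equiv_mxsub n (f g : 'I_n -> 'I_n) (M : 'M[R]_n) :
  injective f -> injective g -> mx_equiv M (mxsub f g M).
Proof.
move=> f_inj g_inj; exists (perm_mx (perm f_inj)), (perm_mx (perm g_inj)^-1).
rewrite !unitmx_perm -row_permE -col_permE; split=> //.
by apply/matrixP=> i j; rewrite !mxE !permE.
Qed.

Lemma unitmx_ublock m n (A : 'M[R]_m) (B : 'M_(m, n)) (D : 'M_n) :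
  (block_mx A B 0 D \in unitmx) = (A \in unitmx) && (D \in unitmx).
Proof. by rewrite !unitmxE det_ublock unitrM. Qed.

Lemma unitmx_lblock m n (A : 'M[R]_m) (C : 'M_(n, m)) (D : 'M_n) :
  (block_mx A 0 C D \in unitmx) = (A \in unitmx) && (D \in unitmx).
Proof. by rewrite !unitmxE det_lblock unitrM. Qed.

Lemma mx_equiv_block_diag m n (A A' : 'M[R]_m) (D D' : 'M[R]_n) :
  mx_equiv A A' -> mx_equiv D D' ->
  mx_equiv (block_mx A 0 0 D) (block_mx A' 0 0 D').
Proof.
move=> [P [Q [uP uQ ->]]] [P' [Q' [uP' uQ' ->]]].
exists (block_mx P 0 0 P'), (block_mx Q 0 0 Q').
rewrite !unitmx_ublock uP uQ uP' uQ'; split=> //.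
by rewrite !mulmx_block !(mul0mx, mulmx0, addr0, add0r).
Qed.

(** Block Gaussian elimination with pivot [A]; the left factor also multiplies the pivot rows by the
    inverse of [A], which normalises the pivot to 1. *)
Lemma mx_equiv_schur m n (A : 'M[R]_m) B C (D : 'M[R]_n) : A \in unitmx ->
  mx_equiv (block_mx A B C D)
           (block_mx 1%:M 0 0 (D - C *m invmx A *m B)).
Proof.
move=> uA; exists (block_mx (invmx A) 0 (- (C *m invmx A)) 1%:M).
exists (block_mx 1%:M (- (invmx A *m B)) 0 1%:M).
rewrite unitmx_lblock unitmx_ublock !unitmx1 unitmx_inv uA; split=> //.
rewrite !mulmx_block !(mul0mx, mulmx0, addr0, mulmx1, mul1mx, add0r).
rewrite mulNmx -[in C *m _ *m A]mulmxA !(mulVmx uA) mul1mx addNr mulmx1 addNr.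
by rewrite mul0mx add0r mulNmx addrC.
Qed.

Lemma mx_equiv_repeated_row m n (A : 'M[R]_m) (L : 'M_(n, m)) :
  mx_equiv (block_mx A 0 (L *m A) 0) (block_mx A 0 0 (0 : 'M_n)).
Proof.
have -> : block_mx A 0 0 (0 : 'M_n)
    = block_mx 1%:M 0 (- L) 1%:M *m block_mx A 0 (L *m A) 0.
  rewrite mulmx_block !(mul0mx, mulmx0, addr0, mulmx1, mul1mx).
  by rewrite mulNmx addNr.
by apply: mx_equivMl; rewrite unitmx_lblock !unitmx1.
Qed.

(** Block reductions yield the invariant factors out of order; permuting rows and columns by the
    same permutation sorts them. *)
Lemma mx_equiv_diag_perm n (s t : seq R) : size s = n -> perm_eq s t ->
  mx_equiv (diag_mx (\row_(i < n) s`_i)) (diag_mx (\row_(i < n) t`_i)).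
Proof.
move=> size_s; rewrite perm_sym => est.
have size_t : size t = n by rewrite -size_s (perm_size est).
have [p Dt] : exists p : 'S_n, t = [seq s`_(p i) | i <- enum 'I_n].
  have /tuple_permP[p Dt] :
    perm_eq (tcast size_t (in_tuple t)) (tcast size_s (in_tuple s)).
    by rewrite !val_tcast.
  exists p; rewrite val_tcast /= in Dt; rewrite Dt; apply: eq_map => i.
  by rewrite (tnth_nth 0) val_tcast.
have -> : diag_mx (\row_(i < n) t`_i) = mxsub p p (diag_mx (\row_(i < n) s`_i)).
  apply/matrixP=> i j; rewrite !mxE (inj_eq perm_inj); congr (_ *+ _).
  by rewrite Dt (nth_map i) ?size_enum_ord // nth_ord_enum.
by apply: mx_equiv_mxsub; apply: perm_inj.
Qed.

Lemma diag_mx_cat m n (s t : seq R) : size s = m ->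
  diag_mx (\row_(i < m + n) (s ++ t)`_i) =
  block_mx (diag_mx (\row_(i < m) s`_i)) 0 0 (diag_mx (\row_(i < n) t`_i)).
Proof.
move=> size_s; rewrite -diag_mx_row; congr diag_mx; apply/rowP=> i.
rewrite mxE; case: (split_ordP i) => k ->.
  by rewrite row_mxEl mxE nth_cat /= size_s ltn_ord.
by rewrite row_mxEr mxE nth_cat /= size_s ltnNge leq_addr /= addKn.
Qed.

Lemma diag_mx_nseq n (a : R) (s : seq R) :
  diag_mx (\row_(i < n) (nseq n a ++ s)`_i) = a%:M.
Proof.
by apply/matrixP=> i j; rewrite !mxE nth_cat size_nseq ltn_ord nth_nseq ltn_ord.
Qed.

(** The coefficients of the [p j] form the transition matrix, which is upper triangular with ones on
    the diagonal because [p j] is monic of degree [j]. *)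
Lemma mx_equiv_krylov n (A : 'M[R]_n.+1) (u : 'cV_n.+1) (p : nat -> {poly R}) :
  (forall k, p k \is monic) -> (forall k, size (p k) = k.+1) ->
  mx_equiv (\matrix_(i, j < n.+1) (A ^+ j *m u) i 0)
           (\matrix_(i, j < n.+1) (horner_mx A (p j) *m u) i 0).
Proof.
move=> p_monic size_p; pose Q := \matrix_(i, j < n.+1) (p j)`_i.
have -> : \matrix_(i, j < n.+1) (horner_mx A (p j) *m u) i 0
    = \matrix_(i, j < n.+1) (A ^+ j *m u) i 0 *m Q.
  apply/matrixP=> i j; rewrite mxE [RHS]mxE.
  have {1}-> : p j = \sum_(k < n.+1) (p j)`_k *: 'X^k.
    rewrite -poly_def; apply/polyP=> k; rewrite coef_poly.
    by case: ltnP => // le_nk; rewrite nth_default // size_p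
      (leq_trans _ le_nk).
  rewrite linear_sum mulmx_suml summxE; apply: eq_bigr => k _.
  by rewrite linearZ /= rmorphXn /= horner_mx_X -scalemxAl !mxE mulrC.
apply: mx_equivMr; rewrite unitmxE -det_tr det_trig.
  rewrite big1 ?unitr1 // => i _; rewrite !mxE.
  by have /monicP := p_monic i; rewrite lead_coefE size_p.
apply/is_trig_mxP => i j lt_ij.
by rewrite !mxE nth_default // size_p.
Qed.
End MatrixEquivalence.

(** * Chebyshev polynomials of the adjacency matrix *)

(* p_2 = x p_1 - 2 p_0, since p_0 is normalised to 1 rather than 2. *)
Fixpoint cheb (k : nat) : {poly int} :=
  if k is k1.+1 then
    if k1 is k2.+1 then 'X * cheb k1 - (if k2 is 0 then 2 else 1) *: cheb k2
    else 'X
  else 1.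

Lemma chebSS k :
  cheb k.+2 = 'X * cheb k.+1 - (if k is 0 then 2 else 1) *: cheb k.
Proof. by []. Qed.

(** The recurrence has order two, so the induction carries two consecutive indices; the subtracted
    term never reaches the leading degree. *)
Lemma cheb_monic_size k : cheb k \is monic /\ size (cheb k) = k.+1.
Proof.
suff [] : (cheb k \is monic /\ size (cheb k) = k.+1) /\
          (cheb k.+1 \is monic /\ size (cheb k.+1) = k.+2) by [].
elim: k => [|k [[_ sz0] [mon1 sz1]]].
  by rewrite /= monic1 size_poly1 monicX size_polyX.
split=> //; have nz1 : cheb k.+1 != 0 by rewrite monic_neq0.
have szX : size ('X * cheb k.+1) = k.+3 by rewrite mulrC size_mulX // sz1.
have lt_sz : (size (- ((if k is 0 then 2 else 1) *: cheb k))
                < size ('X * cheb k.+1)%R)%N.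
  by rewrite szX size_polyN (leq_ltn_trans (size_scale_leq _ _)) // sz0.
rewrite chebSS size_polyDl // szX; split=> //.
by rewrite monicE lead_coefDl // lead_coefM lead_coefX mul1r -monicE.
Qed.

(** The value [a = n] is allowed, with [g n = 0], so that the last vertex of the path can be treated
    as if it had a right neighbour. *)
Lemma sum_ord_indicator n (g : nat -> nat) (a : nat) :
  (a <= n)%N -> g n = 0%N ->
  (\sum_(j < n) (nat_of_ord j == a) * g j)%N = g a.
Proof.
move=> le_an gn0; have [lt_an|le_na] := ltnP a n.
  rewrite (bigD1 (Ordinal lt_an)) //= eqxx mul1n big1 ?addn0 // => j.
  by rewrite -val_eqE /= => /negPf->.
have -> : a = n by lia.
by rewrite gn0 big1 // => j _; rewrite ltn_eqF.
Qed.

Lemma adjacency_dynkinD_col n (g : nat -> nat) :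
  (4 <= n)%N -> g n = 0%N ->
  adjacency_mx (@dynkinD n) *m (\col_i (g i)%:Z) =
  \col_i ((if i < 2 then g 2 else
             if nat_of_ord i == 2 then g 0 + g 1 + g 3
             else g i.-1 + g i.+1)%N)%:Z.
Proof.
move=> n_ge4 gn0; apply/colP=> i; rewrite !mxE.
transitivity (Posz (\sum_(j < n) (dynkinD i j * g j)%N)%N).
  rewrite -[RHS]natz natr_sum; apply: eq_bigr => j _.
  by rewrite !mxE natrM [(g j)%:R]natz.
congr Posz.
have S := sum_ord_indicator _ gn0.
have [lt2|ge2] := ltnP i 2.
  rewrite -S; last by lia.
  apply: eq_bigr => j _; congr (nat_of_bool _ * _)%N.
  by rewrite /dynkinD /dynkinD_arc; lia.
case: eqP => [i2|ne2].
  rewrite -!S; try lia.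
  rewrite -!big_split; apply: eq_bigr => j _ /=; rewrite -!mulnDl.
  by congr (_ * _)%N; rewrite /dynkinD /dynkinD_arc; lia.
have lt_i := ltn_ord i; rewrite -!S; try lia.
rewrite -!big_split; apply: eq_bigr => j _ /=; rewrite -!mulnDl.
by congr (_ * _)%N; rewrite /dynkinD /dynkinD_arc; lia.
Qed.

(* Entry i (0-based, the leaves being 0 and 1) of p_k(A) e for D_n, extended
   by its value 0 at the phantom vertex i = n when k < n - 1. *)
Definition cheb_walk (n k i : nat) : nat :=
  (if k isn't _.+1 then nat_of_bool (i < n)
  else if i < 2 then nat_of_bool (k.+1 < n)
  else (i + k < n).*2 + (i + k == n) + (i == k.+1))%N.

Lemma horner_dynkinD_cheb n k : (4 <= n.+1)%N -> (k <= n)%N ->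
  horner_mx (adjacency_mx (@dynkinD n.+1)) (cheb k) *m const_mx 1 =
  \col_i (cheb_walk n.+1 k i)%:Z.
Proof.
move=> n_ge4.
(* The point mass at [i = k.+1] reaches the phantom vertex only in degree [n], and the recurrence
   multiplies by the adjacency matrix only in degrees below [n]. *)
have walk0 j : (j < n)%N -> cheb_walk n.+1 j n.+1 = 0%N.
  by rewrite /cheb_walk; case: j => [|j]; do ?[case: ifP => ?]; lia.
have step j (lt_jn : (j < n)%N) := adjacency_dynkinD_col n_ge4 (walk0 j lt_jn).
pose claim l := (l <= n)%N ->
  horner_mx (adjacency_mx (@dynkinD n.+1)) (cheb l) *m const_mx 1 =
  \col_i (cheb_walk n.+1 l i)%:Z.
suff: claim k /\ claim k.+1 by case.
have base : const_mx 1 = \col_i (cheb_walk n.+1 0 i)%:Z :> 'cV_n.+1.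
  by apply/colP=> i; rewrite !mxE /cheb_walk /= ltn_ord.
elim: k => [|k [IH0 IH1]].
  rewrite /claim; split=> [_|lt0n]; first by rewrite /= rmorph1 mul1mx base.
  rewrite /= horner_mx_X base step //; apply/colP=> i; rewrite !mxE.
  have := ltn_ord i; rewrite /cheb_walk; do ?[case: ifP => ?]; lia.
split=> // lt_kn.
rewrite chebSS rmorphB rmorphM /= horner_mx_X linearZ /= mulmxBl -mulmxA.
rewrite -scalemxAl IH1 ?IH0 ?step; try lia.
apply/colP=> i; rewrite !mxE.
(* The passage to degree 2 is separate: its coefficient is 2, and degree 0 has its own formula in
   [cheb_walk]. *)
have := ltn_ord i; case: k {IH0 IH1} lt_kn => [|k];
  by rewrite /cheb_walk; do ?[case: ifP => ?]; rewrite -?[(3 < 2)%N]/false; lia.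
Qed.

Lemma walk_mx_equiv_cheb n : (4 <= n)%N ->
  mx_equiv (walk_mx (@dynkinD n)) (\matrix_(i, j < n) (cheb_walk n j i)%:Z).
Proof.
case: n => // n n_ge4.
pose A := adjacency_mx (@dynkinD n.+1); pose e : 'cV[int]_n.+1 := const_mx 1.
have -> : \matrix_(i, j < n.+1) (cheb_walk n.+1 j i)%:Z =
    \matrix_(i, j < n.+1) (horner_mx A (cheb j) *m e) i 0.
  apply/matrixP=> i j.
  by rewrite mxE [RHS]mxE horner_dynkinD_cheb ?mxE // -ltnS.
by apply: mx_equiv_krylov => k; case: (cheb_monic_size k).
Qed.

(** * Paths with an odd number of vertices *)

Definition path_mx n : 'M[int]_n :=
  \matrix_(i, j) ((j == i.+1 :> nat) || (i == j.+1 :> nat))%:R.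

(** The first two vertices span an edge whose matrix is its own inverse. Taking it as pivot leaves
    the path on two vertices fewer, and the induction ends at a single vertex, the entry 0. *)
Lemma mx_equiv_path_odd t :
  mx_equiv (path_mx t.*2.+1)
           (diag_mx (\row_(i < t.*2.+1) (nseq t.*2 1 ++ [:: 0])`_i)).
Proof.
elim: t => [|t IH].
  rewrite (_ : diag_mx _ = path_mx 1); first exact: mx_equiv_refl.
  by apply/matrixP=> i j; rewrite !ord1 !mxE.
(* [B] is the one edge from the removed pair to the rest. The correction in the Schur complement is
   a multiple of the diagonal entry of [path_mx 2] at that endpoint, hence 0. *)
pose B : 'M[int]_(2, t.*2.+1) :=
  \matrix_(i, j) ((i == 1 :> nat) && (j == 0 :> nat))%:R.
have JJ : path_mx 2 *m path_mx 2 = 1%:M.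
  apply/matrixP=> i j; rewrite !mxE !big_ord_recl big_ord0 !mxE.
  by case: i => [[|[|?]] ?] //; case: j => [[|[|?]] ?].
have [uJ _] := mulmx1_unit JJ.
have invJ : invmx (path_mx 2) = path_mx 2.
  by rewrite -[RHS](mulKmx uJ) JJ mulmx1.
have BJB : B^T *m path_mx 2 *m B = 0.
  apply/matrixP=> i j; rewrite !mxE !big_ord_recl big_ord0 !mxE.
  by rewrite !big_ord_recl !big_ord0 !mxE /=; lia.
have -> : path_mx t.+1.*2.+1 = block_mx (path_mx 2) B B^T (path_mx t.*2.+1).
  rewrite -[t.+1.*2.+1]/(2 + t.*2.+1)%N.
  apply/matrixP=> i j; case: (split_ordP i) => i' ->;
    case: (split_ordP j) => j' ->.
  - by rewrite block_mxEul !mxE.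
  - rewrite block_mxEur !mxE /=; congr (nat_of_bool _)%:R.
    by have := ltn_ord i'; lia.
  - rewrite block_mxEdl !mxE /=; congr (nat_of_bool _)%:R.
    by have := ltn_ord j'; lia.
  - by rewrite block_mxEdr !mxE.
apply: mx_equiv_trans (mx_equiv_schur _ _ _ uJ) _.
rewrite invJ BJB subr0.
rewrite -[nseq t.+1.*2 _ ++ _]/(nseq 2 (1 : int) ++ (nseq t.*2 1 ++ [:: 0])).
rewrite (@diag_mx_cat _ 2 t.*2.+1) //; apply: mx_equiv_block_diag => //.
by rewrite -[nseq 2 1]cats0 diag_mx_nseq; apply: mx_equiv_refl.
Qed.

(** * Reduction of the sign block matrix to a path *)

Definition upper_mx n : 'M[int]_n := \matrix_(i, j) (i <= j)%N%:R.
Definition shift_mx n : 'M[int]_n := \matrix_(i, j) (j == i.+1 :> nat)%:R.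

Lemma shift_upper_mx n : shift_mx n *m upper_mx n = upper_mx n - 1%:M.
Proof.
apply/matrixP=> i j; rewrite !mxE.
under eq_bigr => k _ do rewrite !mxE.
have [lt_in|le_ni] := ltnP i.+1 n.
  rewrite (bigD1 (Ordinal lt_in)) //= eqxx mul1r big1 ?addr0 => [|k].
    by rewrite -val_eqE /=; case: ltngtP.
  by rewrite -val_eqE /= => /negPf->; rewrite mul0r.
rewrite big1 => [|k _]; last by rewrite ltn_eqF ?mul0r // (leq_trans _ le_ni).
by rewrite -val_eqE /=; have := ltn_ord i; have := ltn_ord j; lia.
Qed.

(** Off the diagonal blocks, [F - F^T] has entries the signs of [j - i]; on them, [F + F^T] is the
    all-one matrix plus the identity. *)
Definition sign_block_mx n : 'M[int]_(n + n) :=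
  let F := upper_mx n in
  block_mx (F + F^T) (F - F^T) (F^T - F) (2%:M - F - F^T).

Lemma mx_equiv_sign_block n :
  mx_equiv (sign_block_mx n) (block_mx 2%:M 0 0 (path_mx n)).
Proof.
set F := upper_mx n; set N := shift_mx n.
have NF : N *m F = F - 1%:M by exact: shift_upper_mx.
have FN : F^T *m N^T = F^T - 1%:M by rewrite -trmx_mul NF raddfB /= trmx1.
have det_shift : \det (1%:M - N) = 1.
  rewrite -det_tr det_trig.
    by rewrite big1 // => i _; rewrite !mxE eqxx ltn_eqF // subr0.
  apply/is_trig_mxP => i j lt_ij.
  by rewrite !mxE -val_eqE /=; lia.
(* The left factor produces the block rows (2F^T, 2 - 2F^T) and (X, -X) with X = N F^T + F^T - 1.
   The first block column of the right factor adds the two columns, giving 2 and 0; the second gives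
   0 and X (1 - N^T) = N + N^T, because F^T (1 - N^T) = 1. *)
exists (block_mx 1%:M 1%:M N 1%:M), (block_mx 1%:M (- N^T) 1%:M (- 1%:M)).
split.
- have -> : block_mx 1%:M 1%:M N 1%:M =
     block_mx 1%:M 0 N 1%:M *m block_mx 1%:M 1%:M 0 (1%:M - N).
    rewrite mulmx_block !(mul0mx, mulmx0, addr0, mulmx1, mul1mx).
    by rewrite addrC subrK.
  rewrite unitmx_mul unitmx_lblock unitmx_ublock !unitmx1.
  by rewrite unitmxE det_shift unitr1.
- have -> : block_mx 1%:M (- N^T) 1%:M (- 1%:M) =
     block_mx 1%:M 0 1%:M 1%:M *m block_mx 1%:M (- N^T) 0 (- (1%:M - N)^T).
    rewrite mulmx_block !(mul0mx, mulmx0, addr0, mulmx1, mul1mx).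
    by rewrite raddfB /= trmx1 opprB addrA addNr add0r.
  rewrite unitmx_mul unitmx_lblock unitmx_ublock !unitmx1 /=.
  by rewrite unitmxE -scaleN1r detZ det_tr det_shift mulr1 unitrX ?unitrN1.
rewrite /sign_block_mx -/F !mulmx_block !(mul1mx, mulmx1, mulmxN).
rewrite !(mulmxDl, mulmxBl, mulmxBr, mulmxDr, mul1mx, mulmx1) !NF !FN.
rewrite !mulNmx.
rewrite -[N *m _ *m N^T]mulmxA FN mulmxBr !mulmx1 mulmxBl mul1mx.
have -> : path_mx n = N + N^T.
  by apply/matrixP=> i j; rewrite !mxE; lia.
have -> : 2%:M = 1%:M + 1%:M :> 'M[int]_n by rewrite -raddfD.
clear NF FN det_shift; clearbody F N.
move: (F *m N^T) (N *m F^T) (1%:M : 'M[int]_n) F^T N^T => X Y I F' N'.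
by congr block_mx; apply/matrixP=> i j; rewrite !mxE; ring.
Qed.

(** * Rearrangement of the Chebyshev walk values into blocks *)

Lemma ord_block_ind m (P : 'I_(1 + (m + m) + 1) -> Prop) :
    P (lshift 1 (lshift (m + m) ord0)) ->
    (forall a : 'I_m, P (lshift 1 (rshift 1 (lshift m a)))) ->
    (forall a : 'I_m, P (lshift 1 (rshift 1 (rshift m a)))) ->
    P (rshift (1 + (m + m)) ord0) ->
  forall k, P k.
Proof.
move=> P0 Pl Pr P1 k; case: (split_ordP k) => {}k ->; last by rewrite ord1.
case: (split_ordP k) => {}k ->; first by rewrite ord1.
by case: (split_ordP k) => {}k ->.
Qed.

(** Degree 0 gives a column of ones and degree [n - 1] a zero column; both leaves have row 1, ...,
    1, 0. On the other entries the wave takes the values 2, 1, 0 according to the position of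
    [i + k] relative to [n], so subtracting 1 turns it into signs. *)
Lemma cheb_walk_equiv_sign_block m :
  let n := (1 + (m + m) + 1)%N in
  mx_equiv (\matrix_(i, j < n) (cheb_walk n j i)%:Z)
           (block_mx (block_mx 1%:M 0 0 (sign_block_mx m)) 0 0 0).
Proof.
move=> n.
(* Between its first and last value, g lists 1, ..., m, 2m, ..., m + 1, and f
   does the same shifted by one; the two leaves are the first and last row. *)
pose f (i : nat) := (if i == 0 then 0 else if i <= m then i.+1
             else if i <= m + m then m + m + m + 2 - i else 1)%N.
pose g j := (if m < j <= m + m then m + m + m + 1 - j else j)%N.
have ltf (i : 'I_n) : (f i < n)%N.
  by have := ltn_ord i; rewrite /f /n; do ?case: ifP => ?; lia.
have ltg (j : 'I_n) : (g j < n)%N.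
  by have := ltn_ord j; rewrite /g /n; do ?case: ifP => ?; lia.
have f_inj : injective (fun i => Ordinal (ltf i)).
  move=> i j /(congr1 val) /= eq_ij; apply: val_inj; move: eq_ij.
  have := ltn_ord i; have := ltn_ord j.
  by rewrite /f /n /=; do ?case: ifP => ?; lia.
have g_inj : injective (fun j => Ordinal (ltg j)).
  move=> i j /(congr1 val) /= eq_ij; apply: val_inj; move: eq_ij.
  have := ltn_ord i; have := ltn_ord j.
  by rewrite /g /n /=; do ?case: ifP => ?; lia.
apply: mx_equiv_trans (mx_equiv_mxsub _ f_inj g_inj) _.
pose u : 'rV[int]_(m + m) := const_mx 1.
pose v : 'cV[int]_(m + m) := const_mx 1.
(* The pivot 1 comes from the first leaf in degree 0; eliminating with it subtracts the all-one
   matrix [v *m u]. *)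
pose M := block_mx 1%:M u v (sign_block_mx m + v *m u).
have M_schur : mx_equiv M (block_mx 1%:M 0 0 (sign_block_mx m)).
  have := mx_equiv_schur u v (sign_block_mx m + v *m u) (unitmx1 _ 1).
  by rewrite invmx1 mulmx1 addrK.
apply: mx_equiv_trans (mx_equiv_block_diag M_schur (mx_equiv_refl _)).
(* [row_mx 1%:M 0] selects the first row of [M], which the second leaf repeats. *)
apply: mx_equiv_trans (mx_equiv_repeated_row M (row_mx 1%:M 0)).
rewrite mul_row_block !mul1mx !mul0mx !addr0.
rewrite (_ : mxsub _ _ _ = block_mx M 0 (row_mx 1%:M u) 0).
  exact: mx_equiv_refl.
have vu : v *m u = const_mx 1.
  by apply/matrixP=> i j; rewrite !mxE big_ord1 !mxE.
rewrite /M vu /sign_block_mx; apply/matrixP=> i j.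
have f0 : f (lshift 1 (lshift (m + m) (ord0 : 'I_1))) = 0%N by [].
have f1 (a : 'I_m) : f (lshift 1 (rshift 1 (lshift m a))) = a.+2.
  by have := ltn_ord a; rewrite /f /=; case: ifP => ?; lia.
have f2 (a : 'I_m) : f (lshift 1 (rshift 1 (rshift m a))) = ((m + m).+1 - a)%N.
  by have := ltn_ord a; rewrite /f /=; do ?case: ifP => ?; lia.
have f3 : f (rshift (1 + (m + m)) (ord0 : 'I_1)) = 1%N.
  by rewrite /f /=; do ?case: ifP => ?; lia.
have g0 : g (lshift 1 (lshift (m + m) (ord0 : 'I_1))) = 0%N by [].
have g1 (b : 'I_m) : g (lshift 1 (rshift 1 (lshift m b))) = b.+1.
  by have := ltn_ord b; rewrite /g /=; case: ifP => ?; lia.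
have g2 (b : 'I_m) : g (lshift 1 (rshift 1 (rshift m b))) = (m + m - b.+1).+1.
  by have := ltn_ord b; rewrite /g /=; case: ifP => ?; lia.
have g3 : g (rshift (1 + (m + m)) (ord0 : 'I_1)) = (m + m).+1.
  by rewrite /g /=; case: ifP => ?; lia.
have walk0 i' : (i' < n)%N -> cheb_walk n 0 i' = 1%N.
  by rewrite /cheb_walk => ->.
have walk_leaf0 k : cheb_walk n k.+1 0 = (k.+2 < n)%N by [].
have walk_leaf1 k : cheb_walk n k.+1 1 = (k.+2 < n)%N by [].
have walk_path k i' : (2 <= i')%N ->
    cheb_walk n k.+1 i' =
    ((i' + k.+1 < n).*2 + (i' + k.+1 == n) + (i' == k.+2))%N.
  by move=> i'_ge2; rewrite /cheb_walk ltnNge i'_ge2.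
rewrite mxE mxE [val _]/= [val (Ordinal _)]/=.
rewrite -(block_mx_const m m m m) add_block_mx.
elim/ord_block_ind: i => [|a|a|]; elim/ord_block_ind: j => [|b|b|];
  rewrite ?(block_mxEul, block_mxEur, block_mxEdl, block_mxEdr) ?row_mxEl ?row_mxEr.
all: rewrite ?f0 ?f1 ?f2 ?f3 ?g0 ?g1 ?g2 ?g3 !mxE.
all: try have lt_a := ltn_ord a.
all: try have lt_b := ltn_ord b.
all: rewrite ?walk0 ?walk_leaf0 ?walk_leaf1 ?walk_path // /n -?val_eqE /=.
all: lia.
Qed.

(** * Assembly of the Smith normal form *)

Unset Implicit Arguments.
Set Strict Implicit.

Theorem theorem2 (n : nat) (n_ge4 : (4 <= n)%N) (n_div4 : (4 %| n)%N) :
  is_smith_normal_form (walk_mx (@dynkinD n))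
    (diag_mx (\row_(i < n)
       (nseq (n %/ 2 - 1) (1 : int) ++ nseq (n %/ 2 - 1) (2 : int)
          ++ [:: 0; 0])`_i)).
Proof.
(* Here [m = t.*2.+1] is both [n %/ 2 - 1] and the odd length of the path. *)
have [t Dn] : exists t, n = (1 + (t.*2.+1 + t.*2.+1) + 1)%N.
  by exists (n %/ 4).-1; lia.
have -> : (n %/ 2 - 1)%N = t.*2.+1 by lia.
set s := _ ++ _; exists (fun i => s`_i).
have size_s : size s = n by rewrite !size_cat !size_nseq /= Dn; lia.
have nth00 k : [:: 0; 0]`_k = 0 :> int by case: k => [|[|[|?]]].
have Es k : s`_k = if (k < t.*2.+1)%N then 1
                   else if (k - t.*2.+1 < t.*2.+1)%N then 2 else 0.
  rewrite /s !nth_cat !nth_nseq !size_nseq; rewrite nth00.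
  by case: (k < _)%N => //; case: (k - _ < _)%N.
split=> // [i|i j ->|]; rewrite ?Es.
- by do ?case: ifP.
- by do ?case: ifP => ?; try lia; rewrite ?dvd1z ?dvdz0.
suff [P [Q [uP uQ DPQ]]] :
    mx_equiv (walk_mx (@dynkinD n)) (diag_mx (\row_i s`_i)).
  by exists P, Q.
apply: mx_equiv_trans (walk_mx_equiv_cheb n_ge4) _.
move: size_s; rewrite {n_ge4 n_div4}Dn => size_s.
apply: mx_equiv_trans (cheb_walk_equiv_sign_block _) _.
(* [r] lists the diagonal in the order of the reduction: the leaf pivot, the block of twos, the
   path, and the zero from the repeated row and zero column. *)
pose r : seq int :=
  ([:: 1] ++ (nseq t.*2.+1 2 ++ (nseq t.*2 1 ++ [:: 0]))) ++ [:: 0].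
have perm_rs : perm_eq r s.
  apply/seq.permP=> a; rewrite /r /s !(count_cat, count_nseq) /=.
  move: (nat_of_bool (a 0)) (nat_of_bool (a 1)) (nat_of_bool (a 2)) => x y z.
  by rewrite -muln2; ring.
apply: mx_equiv_trans (mx_equiv_diag_perm _ perm_rs).
2: by rewrite (perm_size perm_rs).
rewrite diag_mx_cat; last by rewrite !size_cat !size_nseq /=; lia.
rewrite (@diag_mx_cat _ 1) // (@diag_mx_cat _ t.*2.+1) ?size_nseq //.
apply: mx_equiv_block_diag.
  apply: mx_equiv_block_diag.
    by rewrite -[[:: 1]]cats0 (@diag_mx_nseq _ 1); apply: mx_equiv_refl.
  apply: mx_equiv_trans (mx_equiv_sign_block _) _.
  apply: mx_equiv_block_diag; last exact: mx_equiv_path_odd.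
  by rewrite -[nseq _ _]cats0 diag_mx_nseq; apply: mx_equiv_refl.
rewrite (_ : diag_mx _ = 0); first exact: mx_equiv_refl.
by apply/matrixP=> i j; rewrite !ord1 !mxE.
Qed.
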